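(* Let $n_1,\ldots,n_t$ be positive integers, let $t_e$ and $t_o$ be respectively the number of even and odd integers in the sequence $(n_1,\ldots,n_t)$, and let $f=82\times 35^{2^{t_o}-2}\times 81^{t_e}$. Let $c=\min\{95412,f\}$ if $t=2$ and $c=f$ otherwise. Let $n=\max\{n_1,\ldots,n_t\}$ and $N=cn$, and suppose that for each $1\leq i\leq t$ we have $n_i\geq 2\lceil \log N \rceil+2$. Let $d=d(c)$ be a non-negative real number such that $\varphi(a,c,d)\leq 0$ for every real number $a$ with $0\leq a\leq 1$. Then for sufficiently large $N$ we have $$\hat{R}(C_{n_1},\ldots,C_{n_t})\leq Nd/2.$$
   Context: Let $g(x)=x\ln x$ (with $g(0)=0$) and $$\varphi(a,c,d) = g(c)+g(d)+g((c-2)d)+\tfrac{1}{2}g((c-1-a)d)-g(c-2)-g(ad)-g((c-2-a)d)-\tfrac{1}{2}g((1-a)d)-\tfrac{1}{2}g(cd).$$ $C_k$ denotes the cycle on $k$ vertices. For graphs $G_1,\ldots,G_k$, the size-Ramsey number $\hat{R}(G_1,\ldots,G_k)$ is the smallest integer $m$ for which there exists a graph $H$ with $m$ edges such that for every coloring of the edges of $H$ with colors $1,\ldots,k$ there is, for some $i$, a copy of $G_i$ in $H$ all of whose edges have color $i$. $\log$ denotes the logarithm to base $2$ and $\ln$ the natural logarithm. (The bound is realized by random $d$-regular graphs on $N$ vertices, so $d$ is implicitly an integer with $Nd$ even.) *)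

(* Defs.v *)
From HB Require Import structures.
From mathcomp Require Import all_boot all_order all_algebra.
From mathcomp Require Import all_classical all_reals all_analysis.
Set Implicit Arguments. Unset Strict Implicit. Unset Printing Implicit Defensive.
Import Order.TTheory GRing.Theory Num.Theory.
Local Open Scope ring_scope.

Definition simple_graph (M : nat) (e : rel 'I_M) : Prop :=
  symmetric e /\ irreflexive e.

Definition edge_set (M : nat) (e : rel 'I_M) : {set {set 'I_M}} :=
  [set [set u; v] | u in 'I_M, v in 'I_M & e u v].

(* An edge colouring with colours 'I_t (colours are indexed 0..t-1
   instead of 1..t); only its values on edges matter. *)
Definition colouring (M t : nat) := {set 'I_M} -> 'I_t.

Definition mono_cycle (M t : nat) (e : rel 'I_M) (col : colouring M t)
    (i : 'I_t) (k : nat) : Prop :=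
  exists f : 'I_k -> 'I_M, injective f /\
    forall j : 'I_k, e (f j) (f (ordS j)) /\ col [set f j; f (ordS j)] = i.

Definition ramsey_graph_with_edges (t : nat) (ks : 'I_t -> nat) (m : nat) : Prop :=
  exists (M : nat) (e : rel 'I_M), simple_graph e /\ #|edge_set e| = m /\
    forall col : colouring M t, exists i : 'I_t, mono_cycle e col i (ks i).

(* "size_ramsey(C_{k_1},...,C_{k_t}) <= x": the smallest m such that some
   graph with m edges is Ramsey is at most x, i.e. some such m is <= x. *)
Definition size_ramsey_le (R : realType) (t : nat) (ks : 'I_t -> nat) (x : R) : Prop :=
  exists m : nat, ramsey_graph_with_edges ks m /\ (m%:R <= x).

Definition g (R : realType) (x : R) : R := if x == 0 then 0 else x * ln x.

Definition phi (R : realType) (a c d : R) : R :=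
  g c + g d + g ((c - 2) * d) + 2^-1 * g ((c - 1 - a) * d)
  - g (c - 2) - g (a * d) - g ((c - 2 - a) * d)
  - 2^-1 * g ((1 - a) * d) - 2^-1 * g (c * d).

(* f = 82 * 35^(2^{t_o} - 2) * 81^{t_e}  (the exponent may be -1 if t_o = 0) *)
Definition fconst (R : realType) (te to : nat) : R :=
  82 * exprz (35 : R) ((2 ^ to)%N%:Z - 2%:Z) * 81 ^+ te.

(* c = min{95412, f} (95412 written as 954*100+12 to avoid a huge unary nat literal) if t = 2, c = f otherwise *)
Definition cconst (R : realType) (t te to : nat) : R :=
  if t == 2%N then Num.min (954 * 100 + 12) (fconst R te to) else fconst R te to.

Definition log2 (R : realType) (x : R) : R := ln x / ln 2.

(* Main.v *)
(* Call a graph m-joined when an edge joins any two disjoint vertex sets of size m.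
   A random graph with N d / 2 edges on somewhat fewer than N vertices is n-joined by
   a first moment count: the condition on phi at a = 1 already forces
   3 d >= (c - 2) (2 ln c + 2 (c - 2) / c), and since the number of vertices can be
   taken at most 0.54 N, uniformly random edges are as good as a random regular graph.

   If a colour is m-joined between two sets of size 21 m, then it contains paths of
   any prescribed even order l between all pairs of vertices of two sets of size m on
   opposite sides: take a path by depth-first search and let both of its ends branch
   out in expanding reservoirs, doubling at each step.  One edge closes an even cycle,
   one vertex of a third set joined to both sides closes an odd cycle.
   So a colour without the forbidden cycle leaves, between two (even case) or among
   three (odd case) large sets, two sets of size m without edges of this colour.
   Removing the odd colours first, where three sets are obtained by splitting twice,
   and then the even ones, two sets of size n without any edge would remain. *)
Require Import Defs.
From HB Require Import structures.
From mathcomp Require Import all_boot all_order all_algebra.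
From mathcomp Require Import zify ring lra.
Set Implicit Arguments. Unset Strict Implicit. Unset Printing Implicit Defensive.

(** * Paths of prescribed length in joined bipartite graphs *)

Definition nbr (V : finType) (e : rel V) (X : {set V}) : {set V} :=
  [set y | [exists x in X, e x y]].

Definition joined (V : finType) (e : rel V) (m : nat) (A B : {set V}) : Prop :=
  forall X Y : {set V}, X \subset A -> Y \subset B -> m <= #|X| -> m <= #|Y| ->
  exists2 x, x \in X & exists2 y, y \in Y & e x y.

Definition bijoined (V : finType) (e : rel V) (m : nat) (S : bool -> {set V}) :=
  forall b, joined e m (S b) (S (~~ b)).

Lemma joinedS (V : finType) (e : rel V) m (A B A' B' : {set V}) :
  A' \subset A -> B' \subset B -> joined e m A B -> joined e m A' B'.
Proof.
move=> sA sB jAB X Y sX sY; apply: jAB.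
  exact: subset_trans sX sA.
exact: subset_trans sY sB.
Qed.

Lemma joined_sym (V : finType) (e : rel V) m (A B : {set V}) :
  symmetric e -> joined e m A B -> joined e m B A.
Proof.
move=> se jAB X Y sX sY mX mY; have [y yY [x xX exy]] := jAB Y X sY sX mY mX.
by exists x => //; exists y => //; rewrite se.
Qed.

Lemma bijoinedS (V : finType) (e : rel V) m (S S' : bool -> {set V}) :
  (forall b, S' b \subset S b) -> bijoined e m S -> bijoined e m S'.
Proof. by move=> sS jS b; apply: joinedS (jS b). Qed.

Lemma card_nbr_joined (V : finType) (e : rel V) m (A B X : {set V}) :
  joined e m A B -> X \subset A -> m <= #|X| -> #|B :\: nbr e X| < m.
Proof.
move=> jAB sX mX; rewrite ltnNge; apply/negP => mY.
have [x xX [y /setDP[_ /negP yN] exy]] := jAB _ _ sX (subsetDl _ _) mX mY.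
by apply: yN; rewrite inE; apply/existsP; exists x; rewrite xX.
Qed.

Lemma subset_card_ex (V : finType) (A : {set V}) k :
  k <= #|A| -> exists2 B : {set V}, B \subset A & #|B| = k.
Proof.
case/card_geqP=> s [us <- sA]; exists [set x in s].
  by apply/subsetP=> x; rewrite inE => /sA.
by rewrite cardsE; apply/card_uniqP.
Qed.

(* D is a largest badly expanding family, taken on both sides at once: a badly
   expanding set outside D could be added to it, and joinedness keeps D small. *)
Lemma expander_core (V : finType) (e : rel V) m (S Q : bool -> {set V}) :
  0 < m -> bijoined e m S -> (forall b, Q b \subset S b) ->
  (forall b, 8 * m <= #|Q b|) ->
  exists D : bool -> {set V}, (forall b, #|D b| < m) /\
    forall b (X : {set V}), X \subset S b :\: D b -> 0 < #|X| <= m ->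
      3 * #|X| < #|nbr e X :&: (Q (~~ b) :\: D (~~ b))|.
Proof.
move=> m0 jS sQ cQ.
pose P (D : {ffun bool -> {set V}}) := [forall b, [&& D b \subset S b, #|D b| < m &
  #|nbr e (D b) :&: (Q (~~ b) :\: D (~~ b))| <= 3 * #|D b|]].
have P0 : P [ffun=> set0].
  apply/forallP=> b; rewrite !ffunE sub0set cards0 m0 /= leqn0 cards_eq0.
  by apply/eqP/setP=> y; rewrite !inE; apply/negP => /andP[/existsP[x]]; rewrite inE.
have [D /forallP PD maxD] : exists2 D, P D &
    forall D', P D' -> #|D' true| + #|D' false| <= #|D true| + #|D false|.
  by case: (arg_maxnP (fun D : {ffun bool -> {set V}} => #|D true| + #|D false|) P0) => D; exists D.
exists D; split=> [b|b X sX /andP[X0 Xm]]; first by case/and3P: (PD b).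
have /and3P[sDb cDb nDb] := PD b; have /and3P[sDn cDn nDn] := PD (~~ b).
rewrite negbK in nDn.
rewrite ltnNge; apply/negP => poor.
have sDX : D b :|: X \subset S b.
  by rewrite subUset sDb; apply: subset_trans sX (subsetDl _ _).
have dDX : [disjoint D b & X].
  rewrite disjoint_sym; apply: disjointWl sX _.
  by rewrite -setI_eq0; apply/eqP/setP=> y; rewrite !inE; case: (y \in D b); rewrite ?andbF.
have cDX : #|D b :|: X| = #|D b| + #|X|.
  by rewrite cardsU (disjoint_setI0 dDX) cards0 subn0.
have nU : nbr e (D b :|: X) \subset nbr e (D b) :|: nbr e X.
  apply/subsetP=> y; rewrite !inE => /existsP[x]; rewrite inE => /andP[/orP[] xD exy];
  apply/orP; [left|right]; by apply/existsP; exists x; rewrite xD.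
have poorU : #|nbr e (D b :|: X) :&: (Q (~~ b) :\: D (~~ b))| <= 3 * #|D b :|: X|.
  rewrite cDX mulnDr; apply: leq_trans (leq_add nDb poor).
  apply: leq_trans (leq_card_setU _ _); rewrite -setIUl.
  exact/subset_leq_card/setSI.
(* A small union contradicts maximality. A large one shows why reservoirs have size 8 m: fewer than
   2 m vertices have fewer than 6 m neighbours in the reservoir, [D (~~ b)] takes fewer than m of
   it, and joinedness leaves fewer than m unseen. *)
have [small|big] := ltnP #|D b :|: X| m; last first.
  have := card_nbr_joined (jS b) sDX big; rewrite ltnNge => /negP; apply.
  have := cardsID (nbr e (D b :|: X)) (Q (~~ b) :\: D (~~ b)).
  rewrite (setIC (Q (~~ b) :\: D (~~ b))); have := cardsD (Q (~~ b)) (D (~~ b)).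
  have := subset_leq_card (subsetIr (Q (~~ b)) (D (~~ b))).
  have : #|(Q (~~ b) :\: D (~~ b)) :\: nbr e (D b :|: X)| <= #|S (~~ b) :\: nbr e (D b :|: X)|.
    by apply/subset_leq_card/setSD/(subset_trans (subsetDl _ _)).
  have := cQ (~~ b); move: poorU Xm cDb cDn; rewrite cDX; clear; lia.
pose D' := [ffun c => if c == b then D b :|: X else D c].
have D'b : D' b = D b :|: X by rewrite ffunE eqxx.
have D'n : D' (~~ b) = D (~~ b) by rewrite ffunE; case: (b).
have PD' : P D'.
  apply/forallP=> c; have [->|/eqP nc] := eqVneq c b.
    by rewrite D'b D'n sDX small.
  have -> : c = ~~ b by case: (c) (b) nc => [] [].
  rewrite D'n negbK D'b sDn cDn /=; apply: leq_trans nDn.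
  by apply/subset_leq_card/setIS/setDS/subsetUl.
have := maxD _ PD'.
have tot (E : {ffun bool -> {set V}}) : #|E true| + #|E false| = #|E b| + #|E (~~ b)|.
  by case: (b) => //=; rewrite addnC.
rewrite !tot D'b D'n cDX; move: X0; clear; lia.
Qed.

(* L is the level at distance t from u, Z contains the previous levels; each level
   has only doubled, so removing Z from a threefold expansion is affordable. *)
Lemma grow_levels (V : finType) (e : rel V) m (S Q D : bool -> {set V}) b u t :
  [disjoint S true & S false] -> (forall b, Q b \subset S b) ->
  (forall b (X : {set V}), X \subset S b :\: D b -> 0 < #|X| <= m ->
      3 * #|X| < #|nbr e X :&: (Q (~~ b) :\: D (~~ b))|) ->
  u \in S b :\: D b -> (forall i, i < t -> 2 ^ i <= m) ->
  exists L Z : {set V}, [/\ L \subset S (b (+) odd t) :\: D (b (+) odd t),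
    #|L| = 2 ^ t, #|Z| < 2 ^ t, [disjoint L & Z] &
    forall x, x \in L -> exists s, [/\ path e u s, last u s = x, size s = t,
      uniq (u :: s) & {subset s <= Q true :|: Q false} /\ {subset belast u s <= Z}]].
Proof.
move=> dS sQ exp uS; elim: t => [|t IH] tm.
  exists [set u], set0; rewrite addbF sub1set cards1 cards0; split=> //.
    by rewrite -setI_eq0 setI0.
  by move=> x /set1P->; exists [::]; split.
have [L [Z [sL cL cZ dLZ pL]]] := IH (fun i it => tm i (ltnW it)).
set c := b (+) odd t in sL.
have /= expL := exp _ _ sL; rewrite cL expn_gt0 /= (tm t) // in expL.
have {}expL := expL isT.
have bc : b (+) odd t.+1 = ~~ c by rewrite /= /c; case: (b); case: (odd t).
have dL : [disjoint L & Q (~~ c)].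
  apply: disjointWl (subset_trans sL (subsetDl _ _)) _.
  apply: disjointWr (sQ _) _.
  by case: (c); rewrite // disjoint_sym.
set N := nbr e L :&: _ in expL.
have NZ : 2 ^ t.+1 <= #|N :\: Z|.
  rewrite expnS; have := cardsD N Z; have := subset_leq_card (subsetIr N Z).
  move: expL cZ; clear; lia.
have [L' sL' cL'] := subset_card_ex NZ.
exists L', (Z :|: L); rewrite bc; split=> //.
- apply: subset_trans sL' _; apply: subset_trans (subsetDl _ _) _.
  apply: subset_trans (subsetIr _ _) _; exact: setSD.
- by have := (leq_card_setU Z L).1; rewrite expnS; move: cL cZ; clear; lia.
- rewrite -setI_eq0; apply/eqP/setP=> y; rewrite !inE; apply/negP=> /andP[/(subsetP sL')].
  rewrite !inE => /andP[/negbTE -> /andP[_ /andP[_ yQ]]] /= yL.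
  by rewrite (disjointFr dL yL) in yQ.
move=> y yL'; have := subsetP sL' y yL'.
rewrite !inE => /andP[yZ /andP[/existsP[x /andP[xL exy]] /andP[_ yQ]]].
have [s [ps lst sz us [sQs sZ]]] := pL x xL.
have yL : y \notin L by apply/negP => yL; rewrite (disjointFr dL yL) in yQ.
have sub : {subset u :: s <= Z :|: L}.
  move=> z; rewrite lastI mem_rcons inE lst => /orP[/eqP->|/sZ zZ].
    by rewrite inE xL orbT.
  by rewrite inE zZ.
exists (rcons s y); split.
- by rewrite rcons_path ps lst.
- by rewrite last_rcons.
- by rewrite size_rcons sz.
- suff: uniq (rcons (u :: s) y) by [].
  rewrite rcons_uniq us andbT; apply/negP => /sub.
  by rewrite inE (negbTE yZ) (negbTE yL).
- split; last by rewrite belast_rcons.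
  move=> z; rewrite mem_rcons inE => /orP[/eqP->|/sQs //].
  by rewrite inE; case: (c) yQ => /= ->; rewrite ?orbT.
Qed.

(* Depth-first search: P is the current path, D the set of abandoned vertices;
   no edge joins D to the unexplored vertices, so D never has m vertices on a side. *)
Lemma alternating_path (V : finType) (e : rel V) m (W : bool -> {set V}) r :
  symmetric e -> bijoined e m W -> (forall b, 3 * m <= #|W b|) -> 0 < r <= m ->
  exists p, [/\ uniq p, size p = r, {subset p <= W true :|: W false} &
    sorted [rel x y | e x y && [exists b, (x \in W b) && (y \in W (~~ b))]] p].
Proof.
move=> se jW cW /andP[r0 rm].
set e' := [rel x y | _].
have se' x y : e' x y -> e' y x.
  move=> /andP[exy /existsP[b /andP[xW yW]]]; rewrite /e' /= se exy /=.
  by apply/existsP; exists (~~ b); rewrite negbK yW.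
pose rest (D : {set V}) (P : seq V) := (W true :|: W false) :\: D :\: [set x in P].
(* The measure drops by one when an unexplored vertex joins the path and also when the end of the
   path is abandoned. *)
suff H k D P : 2 * #|rest D P| + size P < k -> uniq P ->
    {subset P <= (W true :|: W false) :\: D} -> sorted e' P -> size P <= r ->
    (forall x y, x \in D -> y \in rest D P -> ~~ e' x y) ->
    (forall b, #|D :&: W b| < m) ->
    exists p, [/\ uniq p, size p = r, {subset p <= W true :|: W false} & sorted e' p].
  apply: (H _ set0 [::] (leqnn _)) => //; first by move=> x y; rewrite inE.
  by move=> b; rewrite set0I cards0 (leq_trans r0).
elim: k D P => [|k IH] D P hk uP sP oP; first by rewrite ltn0 in hk.
rewrite leq_eqVlt => /orP[/eqP sz|sz] noe cD.
  exists P; split=> // x /sP; by rewrite inE => /andP[].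
have push y : y \in rest D P -> sorted e' (y :: P) ->
    exists p, [/\ uniq p, size p = r, {subset p <= W true :|: W false} & sorted e' p].
  move=> yR oyP.
  have yR' := yR; rewrite !inE in yR'; case/and3P: yR' => yP yD yW.
  have restE : rest D (y :: P) = rest D P :\ y.
    by apply/setP=> z; rewrite !inE negb_or -andbA.
  apply: (IH D (y :: P)) => //=.
  - have := cardsD1 y (rest D P); rewrite yR restE; move: hk; clear; lia.
  - by rewrite yP.
  - by move=> x; rewrite inE => /orP[/eqP->|/sP //]; rewrite !inE yD.
  - by move=> x z xD; rewrite restE => /setD1P[_]; apply: noe.
case: P hk uP sP oP sz noe push => [|x P] hk uP sP oP sz noe push.
  have [y yR] : exists y, y \in rest D [::].
    apply/set0Pn; rewrite -card_gt0.
    have := cardsD (W true) D; rewrite setIC.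
    have : #|W true :\: D| <= #|rest D [::]|.
      apply/subset_leq_card/subsetP=> y; rewrite !inE.
      by move=> /andP[-> ->].
    move: (cW true) (cD true) r0 rm; clear; lia.
  exact: (push y).
have [/existsP[y /andP[yR exy]]|/existsPn noy] :=
    boolP [exists y, (y \in rest D (x :: P)) && e' x y].
  apply: (push y yR); change (e' y x && sorted e' (x :: P)).
  by rewrite oP se'.
have xS := sP x (mem_head _ _).
have xW : x \in W true :|: W false by move: xS; rewrite inE => /andP[].
have xP : x \notin P by case/andP: uP.
have restE : rest (x |: D) P = rest D (x :: P).
  apply/setP=> z; rewrite !inE.
  by case: (z == x); case: (z \in P); case: (z \in D).
have noe' y z : y \in x |: D -> z \in rest (x |: D) P -> ~~ e' y z.
  rewrite restE => /setU1P[->|yD] zR; last exact: noe.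
  by have := noy z; rewrite zR.
apply: (IH (x |: D) P) => //.
- by rewrite restE; move: hk => /=; clear; lia.
- by case/andP: uP.
- move=> y yP; have := sP y; rewrite !inE yP orbT => /(_ isT) /andP[yD ->].
  by rewrite (negbTE yD) !orbF andbT; apply: contraNneq xP => <-.
- exact: path_sorted oP.
- by apply: leq_trans sz; rewrite /= leqW.
(* If the abandoned vertices reached m on side [b], the other side would keep at least 3 m - m - (m
   - 1) > m unexplored vertices, and joinedness would give a forbidden edge. *)
move=> b; rewrite ltnNge; apply/negP=> big.
have big' : m <= #|rest (x |: D) P :&: W (~~ b)|.
  have sm : #|(x |: D) :&: W (~~ b)| <= m.
    rewrite setIUl; apply: leq_trans (leq_card_setU _ _) _.
    have := cD (~~ b); have : #|[set x] :&: W (~~ b)| <= 1.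
      by rewrite -(cards1 x) subset_leq_card ?subsetIl.
    clear; lia.
  have sP' : #|[set y in P]| < m.
    by rewrite cardsE (leq_ltn_trans (card_size P)) //; move: sz rm => /=; clear; lia.
  have : #|W (~~ b)| <= #|(x |: D) :&: W (~~ b)| + (#|[set y in P]| +
     #|rest (x |: D) P :&: W (~~ b)|).
    apply: leq_trans (leq_trans (leq_card_setU _ _) (leq_add (leqnn _) (leq_card_setU _ _))).
    apply/subset_leq_card/subsetP=> y yW; rewrite /rest !inE yW.
    have -> : (y \in W true) || (y \in W false).
      by case: (b) yW => /= ->; rewrite ?orbT.
    by rewrite !andbT; case: (y == x); case: (y \in D); case: (y \in P).
  move: sm sP' (cW (~~ b)); clear; lia.
have [y yD [z zR eyz]] := jW b _ _ (subsetIr _ _) (subsetIr _ _) big big'.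
have := noe' y z; rewrite (subsetP (subsetIl _ _) _ yD) (subsetP (subsetIl _ _) _ zR).
move=> /(_ isT isT) /negP; apply; rewrite /e' /= eyz; apply/existsP; exists b.
by rewrite (subsetP (subsetIr _ _) _ yD) (subsetP (subsetIr _ _) _ zR).
Qed.

Lemma bool_choice T (P : bool -> T -> Prop) :
  (forall b, exists x, P b x) -> exists f, forall b, P b (f b).
Proof.
move=> exP; have [x Px] := exP true; have [y Py] := exP false.
by exists (fun b => if b then x else y) => - [].
Qed.

Lemma last_alternating (V : finType) (e : rel V) (W : bool -> {set V}) u p b :
  [disjoint W true & W false] -> u \in W b ->
  path [rel x y | e x y && [exists b, (x \in W b) && (y \in W (~~ b))]] u p ->
  last u p \in W (b (+) odd (size p)).
Proof.
move=> dW; elim: p u b => [|y p IH] u b uW /=; first by rewrite addbF.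
case/andP=> /andP[_ /existsP[c /andP[uc yc]]] /IH.
have -> : b = c.
  apply/eqP; apply: contraT => bc; case: b c uW uc bc {yc} => [] [] // uW uc _.
    by rewrite (disjointFr dW uW) in uc.
  by rewrite (disjointFr dW uc) in uW.
by move=> /(_ _ yc); case: (c); case: (odd _).
Qed.

(* 21 = 8 + 8 + 5: each side is cut into two reservoirs of size 8 m, in which the
   two ends of a path with r vertices branch out t times, and a remainder that
   contains this path after the removal of fewer than 2 m badly expanding vertices. *)
Lemma many_paths (V : finType) (e : rel V) m (S : bool -> {set V}) r t :
  symmetric e -> [disjoint S true & S false] -> bijoined e m S ->
  (forall b, 21 * m <= #|S b|) -> 0 < r <= m -> ~~ odd r ->
  m <= 2 ^ t -> (forall i, i < t -> 2 ^ i <= m) ->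
  exists (b : bool) (X Y : {set V}), [/\ X \subset S b, Y \subset S (~~ b), m <= #|X|, m <= #|Y| &
    forall x y, x \in X -> y \in Y -> exists p, [/\ uniq (x :: p), path e x p,
      last x p = y, size (x :: p) = r + t.*2 &
      {subset x :: p <= S true :|: S false}]].
Proof.
move=> se dS jS cS rm or mt tm; have /andP[r0 r_m] := rm.
have m0 : 0 < m := leq_trans r0 r_m.
have [Q1 Q1P] : exists Q : bool -> {set V}, forall b,
    (Q b \subset S b) /\ (#|Q b| = 8 * m).
  apply: (bool_choice (P := fun b (Q : {set V}) => (Q \subset S b) /\ (#|Q| = 8 * m))) => b.
  have [|Q sQ cQ] := @subset_card_ex _ (S b) (8 * m).
    by apply: leq_trans (cS b); rewrite leq_mul2r orbT.
  by exists Q.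
have [Q2 Q2P] : exists Q : bool -> {set V}, forall b,
    (Q b \subset S b :\: Q1 b) /\ (#|Q b| = 8 * m).
  apply: (bool_choice (P := fun b (Q : {set V}) => (Q \subset S b :\: Q1 b) /\ (#|Q| = 8 * m))) => b.
  have [|Q sQ cQ] := @subset_card_ex _ (S b :\: Q1 b) (8 * m).
    have [sQ1 cQ1] := Q1P b; rewrite cardsD (setIidPr sQ1) cQ1.
    by move: (cS b); clear; lia.
  by exists Q.
have sQ1 b : Q1 b \subset S b by case: (Q1P b).
have sQ2 b : Q2 b \subset S b by case: (Q2P b) => /subset_trans -> //; rewrite subsetDl.
have [|D1 [cD1 exp1]] := expander_core m0 jS sQ1; first by move=> b; case: (Q1P b) => _ ->.
have [|D2 [cD2 exp2]] := expander_core m0 jS sQ2; first by move=> b; case: (Q2P b) => _ ->.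
pose W b := S b :\: Q1 b :\: Q2 b :\: D1 b :\: D2 b.
have inW b x : x \in W b -> [/\ x \in S b, x \notin Q1 b, x \notin Q2 b, x \notin D1 b & x \notin D2 b].
  by rewrite !inE => /and5P[].
have sW b : W b \subset S b by apply/subsetP => x /inW[].
have dW : [disjoint W true & W false] by apply: disjointWl (sW _) (disjointWr (sW _) dS).
have cW b : 3 * m <= #|W b|.
  have [[_ c1] [_ c2]] := (Q1P b, Q2P b).
  have sub (A B : {set V}) : #|A| <= #|A :\: B| + #|B|.
    by rewrite -(cardsID B A) addnC leq_add2l subset_leq_card ?subsetIr.
  have := sub (S b) (Q1 b); have := sub (S b :\: Q1 b) (Q2 b).
  have := sub (S b :\: Q1 b :\: Q2 b) (D1 b).
  have := sub (S b :\: Q1 b :\: Q2 b :\: D1 b) (D2 b).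
  by move: (cS b) (cD1 b) (cD2 b); rewrite /W c1 c2; clear; lia.
have [[|u p] [up szp sp pp]] := alternating_path se (bijoinedS sW jS) cW rm.
  by move: r0; rewrite -szp.
have [b0 uW] : exists b, u \in W b.
  by have := sp u (mem_head _ _); rewrite inE => /orP[]; [exists true | exists false].
(* As r is even, the core path ends on opposite sides; both ends branch out t times, so [X] and [Y]
   lie on opposite sides as well. *)
have vW : last u p \in W (~~ b0).
  have := last_alternating dW uW pp.
  have -> : odd (size p) by move: or; rewrite -szp /= negbK.
  by rewrite addbT.
have {pp} pp : path e u p by apply: sub_path pp => x y /andP[].
have uD : u \in S b0 :\: D1 b0 by have [? _ _ ? _] := inW _ _ uW; apply/setDP.
have vD : last u p \in S (~~ b0) :\: D2 (~~ b0).
  by have [? _ _ _ ?] := inW _ _ vW; apply/setDP.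
have [X [Z1 [sX cX _ _ pX]]] := grow_levels dS sQ1 exp1 uD tm.
have [Y [Z2 [sY cY _ _ pY]]] := grow_levels dS sQ2 exp2 vD tm.
exists (b0 (+) odd t), X, Y; rewrite cX cY; split=> //.
- exact: subset_trans sX (subsetDl _ _).
- by rewrite -addNb; exact: subset_trans sY (subsetDl _ _).
(* Go from [x] back to [u], along the core path, and out to [y]. The pieces are disjoint because the
   core avoids both reservoirs ([WQ]) and the reservoirs avoid each other ([QQ]). *)
move=> x y xX yY.
have [s1 [ps1 l1 z1 u1 [q1 _]]] := pX x xX; have [s2 [ps2 l2 z2 u2 [q2 _]]] := pY y yY.
have revE : x :: rev (belast u s1) = rev (u :: s1) by rewrite (lastI u s1) l1 rev_rcons.
have lastE : last x (rev (belast u s1)) = u.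
  by have := congr1 (last x) revE; rewrite rev_cons last_rcons.
have SQ (Q : bool -> {set V}) z b : (forall b, Q b \subset S b) ->
    z \in Q true :|: Q false -> z \in S b -> z \in Q b.
  move=> sQ; rewrite inE => /orP[] zQ; case: b => // zS.
    by rewrite (disjointFr dS (subsetP (sQ _) _ zQ)) in zS.
  by rewrite (disjointFl dS (subsetP (sQ _) _ zQ)) in zS.
have WQ z : z \in W true :|: W false ->
    (z \notin Q1 true :|: Q1 false) && (z \notin Q2 true :|: Q2 false).
  move=> zW; have [b zb] : exists b, z \in W b.
    by move: zW; rewrite inE => /orP[]; [exists true | exists false].
  have [zS z1' z2' _ _] := inW _ _ zb.
  by apply/andP; split; [apply: contra z1'|apply: contra z2'] => zQ; apply: SQ zS.
have QQ z : z \in Q1 true :|: Q1 false -> z \in Q2 true :|: Q2 false -> False.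
  move=> z1' z2'; have [b zb] : exists b, z \in Q2 b.
    by move: z2'; rewrite inE => /orP[]; [exists true | exists false].
  have /setDP[zS /negP] := subsetP (Q2P b).1 _ zb; apply; exact: SQ zS.
exists (rev (belast u s1) ++ p ++ s2); split.
- rewrite -cat_cons revE !cat_uniq rev_uniq u1 /=.
  have -> : uniq p by case/andP: up.
  have -> : uniq s2 by case/andP: u2.
  rewrite andbT /=; apply/andP; split.
    rewrite has_cat negb_or; apply/andP; split; apply/hasPn=> z zp;
      rewrite /= mem_rev inE negb_or.
      have /andP[zQ _] := WQ z (sp z (mem_behead (s := u :: p) zp)).
      apply/andP; split; first by apply: contraTneq zp => ->; case/andP: up.
      by apply: contra zQ => /q1.
    apply/andP; split; last by apply/negP => /q1 /QQ; apply; exact: q2.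
    apply: contraTneq (q2 z zp) => ->.
    by have /andP[] := WQ u (sp u (mem_head _ _)).
  apply/hasPn=> z /q2 zs; apply: contraL zs => zp.
  by have /andP[] := WQ z (sp z (mem_behead (s := u :: p) zp)).
- rewrite !cat_path lastE pp ps2 !andbT -l1 rev_path.
  by rewrite (eq_path (e' := e)) // => a c; rewrite se.
- by rewrite !last_cat lastE.
- rewrite /= !size_cat size_rev size_belast z1 z2 -szp /= -addnn; clear; lia.
have QS (Q : bool -> {set V}) : (forall b, Q b \subset S b) ->
    {subset Q true :|: Q false <= S true :|: S false}.
  by move=> sQ; apply/subsetP/setUSS.
move=> z; rewrite -cat_cons revE !mem_cat mem_rev inE.
case/or3P=> [/orP[/eqP->|/q1]|zp|/q2].
- by apply: QS sW _ _; apply: sp; rewrite mem_head.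
- exact: QS.
- by apply: QS sW _ _; apply: sp; rewrite inE zp orbT.
- exact: QS.
Qed.

(** * Splitting off colours *)

(** The branching depth is [up_log 2 m], the first level that reaches size m; the core path takes
    the remaining even number of vertices, at least 2. [T] only bounds this depth, so that the
    condition on l can be stated independently of the scale m. *)
Lemma exact_paths (V : finType) (e : rel V) m (S : bool -> {set V}) l T :
  symmetric e -> [disjoint S true & S false] -> bijoined e m S ->
  (forall b, 21 * m <= #|S b|) -> ~~ odd l -> T.*2 + 2 <= l <= m -> m <= 2 ^ T ->
  exists (b : bool) (X Y : {set V}),
    [/\ X \subset S b, Y \subset S (~~ b), m <= #|X|, m <= #|Y| &
    forall x y, x \in X -> y \in Y -> exists p, [/\ uniq (x :: p), path e x p,
      last x p = y, size (x :: p) = l & {subset x :: p <= S true :|: S false}]].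
Proof.
move=> se dS jS cS ol /andP[Tl lm] mT.
have tT : up_log 2 m <= T by apply: up_log_min.
have tl : (up_log 2 m).*2 + 2 <= l by apply: leq_trans Tl; rewrite leq_add2r leq_double.
have [|||| b [X [Y [sX sY cX cY pXY]]]] :=
  @many_paths _ e m S (l - (up_log 2 m).*2) (up_log 2 m) se dS jS cS.
- by move: tl lm; clear; lia.
- by rewrite oddB ?odd_double ?addbF //; move: tl; clear; lia.
- exact: up_logP.
- move=> i; rewrite ltnNge; apply: contraR; rewrite -ltnNge => /ltnW.
  exact: up_log_min.
exists b, X, Y; split=> // x y xX yY; have [p [up pp lp szp sp]] := pXY x y xX yY.
by exists p; rewrite szp subnK //; move: tl; clear; lia.
Qed.

Definition has_cycle (V : finType) (e : rel V) (l : nat) : Prop :=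
  exists p, [/\ uniq p, cycle e p & size p = l].

Lemma even_cycle (V : finType) (e : rel V) m (S : bool -> {set V}) l T :
  symmetric e -> [disjoint S true & S false] -> bijoined e m S ->
  (forall b, 21 * m <= #|S b|) -> ~~ odd l -> T.*2 + 2 <= l <= m -> m <= 2 ^ T ->
  has_cycle e l.
Proof.
move=> se dS jS cS ol lm mT.
have [b [X [Y [sX sY cX cY pXY]]]] := exact_paths se dS jS cS ol lm mT.
have [x xX [y yY exy]] := jS b X Y sX sY cX cY.
have [p [up pp lp szp _]] := pXY x y xX yY.
by exists (x :: p); split=> //; rewrite /= rcons_path pp lp se.
Qed.

(** Take paths on l - 1 vertices, an even number. Each of the two end sets misses fewer than m
    vertices of [Y], so some vertex of [Y] sees both and closes the cycle. *)
Lemma odd_cycle (V : finType) (e : rel V) m (S : bool -> {set V}) (Y : {set V}) l T :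
  symmetric e -> [disjoint S true & S false] -> bijoined e m S ->
  (forall b, [disjoint S b & Y]) -> (forall b, joined e m (S b) Y) ->
  (forall b, 21 * m <= #|S b|) -> 2 * m <= #|Y| ->
  odd l -> T.*2 + 2 <= l <= m -> m <= 2 ^ T -> has_cycle e l.
Proof.
move=> se dS jS dY jY cS cY ol /andP[Tl lm] mT.
have [|||b [X1 [X2 [sX1 sX2 cX1 cX2 pX]]]] := @exact_paths _ e m S l.-1 T se dS jS cS.
- by move: ol Tl; clear; lia.
- by move: ol Tl lm; clear; lia.
- exact: mT.
have n1 := card_nbr_joined (jY b) sX1 cX1.
have n2 := card_nbr_joined (jY (~~ b)) sX2 cX2.
have [w wN] : exists w, w \in Y :\: (Y :\: nbr e X1 :|: Y :\: nbr e X2).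
  apply/set0Pn; rewrite -card_gt0.
  have sub (A B : {set V}) : #|A| <= #|A :\: B| + #|B|.
    by rewrite -(cardsID B A) addnC leq_add2l subset_leq_card ?subsetIr.
  have := sub Y (Y :\: nbr e X1 :|: Y :\: nbr e X2).
  have := (leq_card_setU (Y :\: nbr e X1) (Y :\: nbr e X2)).1.
  move: n1 n2 cY; clear; lia.
move: wN; rewrite !inE negb_or !negb_and !negbK => /andP[/andP[w1 w2] wY].
rewrite wY !orbF in w1 w2.
have [x /andP[xX exw]] := existsP w1; have [y /andP[yX eyw]] := existsP w2.
have [p [up pp lp szp sp]] := pX x y xX yX.
exists (w :: x :: p); split.
- rewrite cons_uniq up andbT; apply/negP => /sp.
  by rewrite inE => /orP[] wS; have := disjointFr (dY _) wS; rewrite wY.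
- rewrite /= rcons_path pp lp eyw se exw //.
- by move: szp ol => /= ->; clear; lia.
Qed.

Definition edge_free (V : finType) (e : rel V) (X Y : {set V}) : Prop :=
  forall x y, x \in X -> y \in Y -> ~~ e x y.

Lemma edge_freeS (V : finType) (e : rel V) (X Y X' Y' : {set V}) :
  X' \subset X -> Y' \subset Y -> edge_free e X Y -> edge_free e X' Y'.
Proof. by move=> /subsetP sX /subsetP sY f x y /sX xX /sY yY; apply: f. Qed.

Lemma joined_or_edge_free (V : finType) (e : rel V) m (A B : {set V}) :
  joined e m A B \/ exists X Y : {set V},
    [/\ X \subset A, Y \subset B, m <= #|X|, m <= #|Y| & edge_free e X Y].
Proof.
pose bad (X Y : {set V}) := [&& X \subset A, Y \subset B, m <= #|X|, m <= #|Y| &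
  [forall x in X, forall y in Y, ~~ e x y]].
have [/existsP[X /existsP[Y]]|/existsPn nobad] := boolP [exists X, exists Y, bad X Y].
  case/and5P=> sX sY cX cY /forall_inP f; right; exists X, Y; split=> //.
  by move=> x y xX yY; have /forall_inP := f x xX; apply.
left=> X Y sX sY cX cY; have /existsPn/(_ Y) := nobad X.
rewrite /bad sX sY cX cY /= negb_forall => /existsP[x].
rewrite negb_imply negb_forall => /andP[xX /existsP[y]].
by rewrite negb_imply negbK => /andP[yY exy]; exists x => //; exists y.
Qed.

(** Quantifying over all scales m >= n and all sets U lets the induction on colours apply this at
    multiples of m and inside parts of earlier splits. *)
Definition splits (V : finType) (n : nat) (e : rel V) (F : nat) : Prop :=
  forall m (U : {set V}), n <= m -> F * m <= #|U| ->
  exists X Y : {set V}, [/\ X :|: Y \subset U, [disjoint X & Y],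
    m <= #|X|, m <= #|Y| & edge_free e X Y].

(* The shape needed to close an odd cycle: paths run between the two parts of size
   21 m, and one vertex of the third part joins the two ends. *)
Definition splits3 (V : finType) (n : nat) (e : rel V) (F : nat) : Prop :=
  forall m (U : {set V}), n <= m -> F * m <= #|U| ->
  exists (S : bool -> {set V}) (Y : {set V}), [/\ S true :|: S false :|: Y \subset U,
    [disjoint S true & S false] /\ (forall b, [disjoint S b & Y]),
    forall b, 21 * m <= #|S b|, 2 * m <= #|Y| &
    edge_free e (S true) (S false) /\ (forall b, edge_free e (S b) Y)].

Lemma splits3_empty (V : finType) n (e : rel V) :
  (forall x y, ~~ e x y) -> splits3 n e 44.
Proof.
move=> e0 m U _ cU; have sub (A B : {set V}) : B \subset A -> #|A :\: B| = #|A| - #|B|.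
  by move=> sBA; rewrite cardsD (setIidPr sBA).
have [|S1 s1 c1] := @subset_card_ex _ U (21 * m); first by move: cU; clear; lia.
have [|S2 s2 c2] := @subset_card_ex _ (U :\: S1) (21 * m).
  by rewrite sub // c1; move: cU; clear; lia.
have d12 : [disjoint S1 & S2] by rewrite disjoint_sym; case/subsetDP: s2.
have dU (A B : {set V}) : [disjoint A & B :\: A].
  by rewrite -setI_eq0; apply/eqP/setP=> x; rewrite !inE; case: (x \in A).
exists (fun b => if b then S1 else S2), (U :\: (S1 :|: S2)); split.
- rewrite !subUset s1 subsetDl (subset_trans s2) ?subsetDl //.
- split=> // b; apply: disjointWl (dU (S1 :|: S2) U).
  by case: b; rewrite ?subsetUl ?subsetUr.
- by case; rewrite ?c1 ?c2.
- rewrite -setDDl !sub ?c1 ?c2 //; move: cU; clear; lia.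
- by split=> [|b] x y _ _.
Qed.

(* Split at scale 21 F m, then split one of the two parts again at scale 21 m. *)
Lemma splits3_of_splits (V : finType) n (e : rel V) F :
  0 < F -> splits n e F -> splits3 n e (21 * F ^ 2).
Proof.
move=> F0 spl m U nm cU.
have [||X [Y [sXY dXY cX cY fXY]]] := spl (21 * F * m) U.
- by apply: leq_trans nm _; rewrite leq_pmull // muln_gt0.
- by apply: leq_trans cU; rewrite -mulnn !mulnA (mulnC F) leqnn.
have [||X1 [X2 [sX dX c1 c2 f12]]] := spl (21 * m) X.
- by apply: leq_trans nm _; rewrite leq_pmull.
- by apply: leq_trans cX; rewrite mulnA (mulnC F).
move: sXY sX; rewrite !subUset => /andP[sXU sYU] /andP[s1 s2].
exists (fun b => if b then X1 else X2), Y; split.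
- by rewrite !subUset sYU !(subset_trans _ sXU).
- split=> // b; apply: disjointWl dXY; by case: b.
- by case.
- apply: leq_trans cY; rewrite leq_mul2r -[2]muln1 leq_mul // orbT //.
- by split=> // b; apply: edge_freeS fXY => //; case: b.
Qed.

(** [H] comes first so that adding a colour agrees by computation with [has] on a list with a new
    head. *)
Definition union_rel (V : finType) (G H : rel V) : rel V := [rel x y | H x y || G x y].

(** If [H] were m-joined between all three pairs of parts, it would contain the odd cycle. So some
    pair contains two m-sets free of [H], and they are already free of [G]. The factor does not grow
    here; the cost lies in obtaining three parts. *)
Lemma splits_odd (V : finType) n (G H : rel V) F l T :
  symmetric H -> odd l -> T.*2 + 2 <= l <= n -> 0 < F -> #|V| <= 2 ^ T ->
  ~ has_cycle H l -> splits3 n G F -> splits n (union_rel G H) F.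
Proof.
move=> sH ol /andP[Tl ln] F0 cV noC spl m U nm cU.
have [S [Y [sU [dS dY] cS cY [fS fY]]]] := spl m U nm cU.
(* Every scale that occurs is at most the number of vertices, so one [T] serves all of them. *)
have mT : m <= 2 ^ T.
  apply: leq_trans cV; apply: leq_trans (max_card (mem U)).
  by apply: leq_trans cU; rewrite leq_pmull.
move: sU; rewrite !subUset => /andP[/andP[sS1 sS2] sY].
have sS b : S b \subset U by case: b.
have finish (A B : {set V}) : A \subset U -> B \subset U -> [disjoint A & B] -> edge_free G A B ->
    (exists X Y : {set V}, [/\ X \subset A, Y \subset B, m <= #|X|, m <= #|Y| & edge_free H X Y]) ->
    exists X Y : {set V}, [/\ X :|: Y \subset U, [disjoint X & Y], m <= #|X|, m <= #|Y| &
      edge_free (union_rel G H) X Y].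
  move=> sA sB dAB fAB [X [Z [sX sZ cX cZ fXZ]]]; exists X, Z; split=> //.
  - by rewrite subUset (subset_trans sX) ?(subset_trans sZ).
  - exact: disjointWl sX (disjointWr sZ dAB).
  move=> x z xX zZ; rewrite /union_rel /= negb_or fXZ //=.
  exact: edge_freeS sX sZ fAB _ _ xX zZ.
have [jS|] := joined_or_edge_free H m (S true) (S false); last exact: finish.
have [j1|] := joined_or_edge_free H m (S true) Y; last exact: finish.
have [j2|] := joined_or_edge_free H m (S false) Y; last exact: finish.
case: noC; apply: (odd_cycle sH dS _ dY _ cS cY ol _ mT) => //.
- by case=> //=; apply: joined_sym.
- by case.
- by rewrite Tl (leq_trans ln).
Qed.

(** Splitting [G] at scale 21 m gives the two parts required by [even_cycle]; this is the factor
    21. *)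
Lemma splits_even (V : finType) n (G H : rel V) F l T :
  symmetric H -> ~~ odd l -> T.*2 + 2 <= l <= n -> 0 < F -> #|V| <= 2 ^ T ->
  ~ has_cycle H l -> splits n G F -> splits n (union_rel G H) (F * 21).
Proof.
move=> sH ol /andP[Tl ln] F0 cV noC spl m U nm cU.
have [||X [Y [sXY dXY cX cY fXY]]] := spl (21 * m) U.
- by apply: leq_trans nm _; rewrite leq_pmull.
- by rewrite mulnA.
have mT : m <= 2 ^ T.
  apply: leq_trans cV; apply: leq_trans (max_card (mem U)).
  by apply: leq_trans cU; rewrite leq_pmull // muln_gt0 F0.
have [jXY|[X' [Y' [sX sY cX' cY' fXY']]]] := joined_or_edge_free H m X Y.
  case: noC; apply: (@even_cycle _ _ m (fun b => if b then X else Y) l T) => //.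
  - by case=> //=; apply: joined_sym.
  - by case.
  - by rewrite Tl (leq_trans ln).
exists X', Y'; split=> //.
- exact: subset_trans (setUSS sX sY) sXY.
- exact: disjointWl sX (disjointWr sY dXY).
move=> x y xX yY; rewrite /union_rel /= negb_or fXY' //=.
exact: edge_freeS sX sY fXY _ _ xX yY.
Qed.

(* 44 = 21 + 21 + 2 suffices for splits3 when no colour has been removed yet. *)
Fixpoint odd_bound k : nat :=
  match k with
  | 0 => 2
  | k'.+1 => if k' is 0 then 44 else 21 * odd_bound k' ^ 2
  end.

Lemma odd_bound_gt1 k : 1 < odd_bound k.
Proof.
elim: k => [//|[//|k] IH].
have sq0 : 0 < odd_bound k.+1 ^ 2 by rewrite expn_gt0 ltnW.
exact: leq_trans (leq_pmulr 21 sq0).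
Qed.

Lemma odd_bound_gt0 k : 0 < odd_bound k.
Proof. exact/ltnW/odd_bound_gt1. Qed.

(** An odd colour squares the factor while an even one multiplies it by 21, so the odd colours go
    first, before there is a product to be squared. *)
Lemma splits_colours (V : finType) (I : eqType) n T (H : I -> rel V) (l : I -> nat)
    (so se : seq I) :
  0 < n -> #|V| <= 2 ^ T -> (forall i, symmetric (H i)) ->
  (forall i, T.*2 + 2 <= l i <= n) -> (forall i, ~ has_cycle (H i) (l i)) ->
  all (fun i => odd (l i)) so -> all (fun i => ~~ odd (l i)) se ->
  splits n [rel x y | has (fun i => H i x y) (se ++ so)]
    (odd_bound (size so) * 21 ^ size se).
Proof.
move=> n0 cV sH lT noC odd_so; elim: se => [_|i se IH] /=.
  rewrite muln1.
  (* The induction carries [splits3] along: [splits_odd] consumes a three-part split to remove a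
     colour, and the next one is rebuilt at cost 21 F^2. *)
  suff [] : splits n [rel x y | has (fun i => H i x y) so] (odd_bound (size so)) /\
    splits3 n [rel x y | has (fun i => H i x y) so] (odd_bound (size so).+1) by [].
  elim: so odd_so => [_|i so IH /= /andP[oi /IH[_ IH3]]].
    split; last exact: splits3_empty.
    move=> m U nm cU; have [|X sX cX] := @subset_card_ex _ U m.
      by apply: leq_trans cU; rewrite leq_pmull.
    exists X, (U :\: X); split.
    - by rewrite subUset sX subsetDl.
    - by rewrite -setI_eq0; apply/eqP/setP=> x; rewrite !inE; case: (x \in X).
    - by rewrite cX.
    - by rewrite cardsD (setIidPr sX) cX; move: cU => /=; clear; lia.
    - by [].
  have spl := splits_odd (sH i) oi (lT i) (odd_bound_gt0 _) cV (@noC i) IH3.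
  split; first exact: spl.
  exact: splits3_of_splits (odd_bound_gt0 (size so).+1) spl.
case/andP=> ei /IH{}IH; rewrite expnSr mulnA.
by apply: splits_even (sH i) ei (lT i) _ cV (@noC i) IH; rewrite muln_gt0 odd_bound_gt0 expn_gt0.
Qed.

(** * The host graph *)

(** Draw E ordered pairs of vertices independently. Two given disjoint n-sets are missed by (|V|^2 -
    2 n^2)^E outcomes, and there are at most C(|V|, n)^2 choices of the sets, so some outcome hits
    all of them. *)
Lemma hitting_pairs (V : finType) (n E : nat) :
  'C(#|V|, n) ^ 2 * (#|V| ^ 2 - 2 * n ^ 2) ^ E < (#|V| ^ 2) ^ E ->
  exists f : {ffun 'I_E -> V * V}, forall A B : {set V}, #|A| = n -> #|B| = n ->
    [disjoint A & B] -> exists i, f i \in setX A B :|: setX B A.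
Proof.
move=> lt.
pose dr := [set A : {set V} | #|A| == n].
pose P := [set p : {set V} * {set V} | [&& p.1 \in dr, p.2 \in dr & [disjoint p.1 & p.2]]].
pose free (p : {set V} * {set V}) (f : {ffun 'I_E -> V * V}) :=
  [forall i, f i \notin setX p.1 p.2 :|: setX p.2 p.1].
have [/existsP[f fP]|/existsPn noP] := boolP [exists f, [forall p in P, ~~ free p f]].
  exists f => A B cA cB dAB; have := forall_inP fP (A, B).
  rewrite !inE cA cB eqxx dAB => /(_ isT); rewrite negb_forall => /existsP[i].
  by rewrite negbK; exists i.
suff : (#|V| ^ 2) ^ E <= 'C(#|V|, n) ^ 2 * (#|V| ^ 2 - 2 * n ^ 2) ^ E by rewrite leqNgt lt.
have cardF p : p \in P -> #|[pred f | free p f]| = (#|V| ^ 2 - 2 * n ^ 2) ^ E.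
  rewrite !inE => /and3P[/eqP c1 /eqP c2 d12].
  have -> : #|V| ^ 2 - 2 * n ^ 2 = #|~: (setX p.1 p.2 :|: setX p.2 p.1)|.
    rewrite cardsCs setCK card_prod cardsU !cardsX c1 c2 -mulnn -mulnn mul2n addnn.
    suff -> : setX p.1 p.2 :&: setX p.2 p.1 = set0 by rewrite cards0 subn0.
    apply/setP=> -[x y]; rewrite !inE /=; apply/negP => /andP[/andP[x1 _] /andP[x2 _]].
    by rewrite (disjointFr d12 x1) in x2.
  rewrite -[in RHS](card_ord E) -card_ffun_on; apply: eq_card => f.
  rewrite !inE; apply/forallP/ffun_onP => H i; have := H i; by rewrite in_setC.
have -> : (#|V| ^ 2) ^ E = \sum_(f : {ffun 'I_E -> V * V}) 1.
  by rewrite sum1_card card_ffun card_ord card_prod mulnn.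
(* Otherwise every outcome is counted at least once by a pair of sets that it misses; exchange the
   two sums. *)
apply: (@leq_trans (\sum_(f : {ffun 'I_E -> V * V}) \sum_(p in P) free p f)).
  apply: leq_sum => f _; have := noP f; rewrite negb_forall => /existsP[p].
  by rewrite negb_imply negbK => /andP[pP fp]; rewrite (bigD1 p) //= fp.
rewrite exchange_big /=.
rewrite (eq_bigr (fun=> (#|V| ^ 2 - 2 * n ^ 2) ^ E)) => [|p pP]; last first.
  by rewrite -(cardF p pP) -sum1_card [in RHS]big_mkcond.
rewrite sum_nat_const leq_mul2r; apply/orP; right.
apply: (@leq_trans #|setX dr dr|); last by rewrite cardsX card_draws mulnn.
by apply/subset_leq_card/subsetP=> p; rewrite !inE => /and3P[-> -> _].
Qed.

(** Drawn loops are dropped and repeated pairs coincide, hence at most E edges. *)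
Lemma host_graph (M n E : nat) :
  ('C(M, n) ^ 2 * (M ^ 2 - 2 * n ^ 2) ^ E < (M ^ 2) ^ E)%N ->
  exists e : rel 'I_M, [/\ simple_graph e, #|edge_set e| <= E &
    forall A B : {set 'I_M}, [disjoint A & B] -> (n <= #|A|)%N -> (n <= #|B|)%N ->
      ~ edge_free e A B].
Proof.
move=> lt; have [|f hit] := @hitting_pairs 'I_M n E; first by rewrite card_ord.
pose e : rel 'I_M := [rel x y | (x != y) && [exists i, (f i == (x, y)) || (f i == (y, x))]].
exists e; split.
- split=> [x y|x]; rewrite /e /= ?eqxx // eq_sym; congr andb.
  by apply: eq_existsb => i; rewrite orbC.
- apply: (@leq_trans #|[set [set (f i).1; (f i).2] | i in 'I_E]|).
    apply/subset_leq_card/subsetP=> s /imset2P[x y _].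
    rewrite inE => /andP[_ /andP[_ /existsP[i]]] /orP[] /eqP fi ->; apply/imsetP; exists i => //.
      by rewrite fi.
    by rewrite fi setUC.
  by apply: leq_trans (leq_imset_card _ _) _; rewrite card_ord.
move=> A B dAB nA nB fr.
have [A' sA cA] := subset_card_ex nA; have [B' sB cB] := subset_card_ex nB.
have dAB' : [disjoint A' & B'] by apply: disjointWl sA (disjointWr sB dAB).
have key x y : x \in A' -> y \in B' -> e x y -> False.
  by move=> xA yB; apply/negP/fr; [apply: (subsetP sA)|apply: (subsetP sB)].
have ne x y : x \in A' -> y \in B' -> x != y.
  by move=> xA yB; apply: contraTneq yB => <-; rewrite (disjointFr dAB' xA).
have [i] := hit A' B' cA cB dAB'.
case Ef : (f i) => [x y]; rewrite !inE /= => /orP[] /andP[xA yB].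
  by apply: (key x y xA yB); rewrite /e /= ne //; apply/existsP; exists i; rewrite Ef eqxx.
apply: (key y x yB xA); rewrite /e /= ne //; apply/existsP; exists i.
by rewrite Ef eqxx orbT.
Qed.

Lemma mono_cycle_of_has_cycle (M t : nat) (e : rel 'I_M) (col : colouring M t) (i : 'I_t) k :
  has_cycle [rel x y : 'I_M | e x y && (col [set x; y] == i)] k -> (0 < k)%N ->
  Defs.mono_cycle e col i k.
Proof.
move=> [[|x p] [up cp <-]] // _.
exists (fun j => nth x (x :: p) j); split.
  by move=> a b /eqP; rewrite nth_uniq // => /eqP; exact: val_inj.
move=> j; have jp := ltn_ord j.
have /(pathP x)/(_ j) := cp; rewrite size_rcons => /(_ jp).
have -> : nth x (x :: rcons p x) j = nth x (x :: p) j.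
  by rewrite -rcons_cons nth_rcons jp.
(* At the last index [ordS] wraps around to 0, matching the final [x] of [rcons p x]. *)
have -> : nth x (rcons p x) j = nth x (x :: p) (ordS j).
  rewrite nth_rcons /=; case: ltngtP => [lt|gt|jE].
  - by rewrite modn_small.
  - by have := leq_trans gt (jp : (j <= size p)%N); rewrite ltnn.
  - by rewrite jE modnn.
by case/andP=> ej /eqP.
Qed.

(* The first moment count in real numbers *)
From mathcomp Require Import all_classical all_reals all_analysis.
Import Order.TTheory GRing.Theory Num.Theory.
Local Open Scope ring_scope.

Lemma ln_sub_le (R : realType) (x y : R) : 0 < x -> 0 < y -> ln x - ln y <= (x - y) / y.
Proof.
move=> x0 y0; have xy0 : 0 < x / y by rewrite divr_gt0.
have := @le_ln1Dx R (x / y - 1); rewrite subrKC ln_div ?posrE //.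
rewrite mulrBl divff ?gt_eqF //; apply; lra.
Qed.

(** This is the bound (e p)^n: the falling factorial is at most (p n)^n, and n^n / n! is a single
    term of the series of exp n. *)
Lemma binomial_le_expR (R : realType) (p n : nat) : (0 < p)%N ->
  ('C(p * n, n)%:R : R) <= expR (n%:R * (1 + ln p%:R)).
Proof.
move=> p0; have p0R : (0 : R) < p%:R by rewrite ltr0n.
case: n => [|n]; first by rewrite mul0r expR0 bin0.
have f0 : (0 : R) < (n.+1)`!%:R by rewrite ltr0n fact_gt0.
rewrite -(ler_pM2r f0) -natrM bin_ffact.
apply: (@le_trans _ _ ((p%:R ^+ n.+1) * (n.+1%:R ^+ n.+1))).
  rewrite -exprMn -natrM -natrX ler_nat ffact_prod.
  rewrite -[X in (_ <= _ ^ X)%N]card_ord -prod_nat_const.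
  by apply: leq_prod => i _; exact: leq_subr.
have := @expR_ge1Dxn R n.+1%:R n (ler0n R n.+1).
rewrite mulrDr mulr1 expRD (expRM_natl n.+1) lnK ?posrE // => h.
rewrite mulrC [X in _ <= X]mulrAC ler_pM2r ?exprn_gt0 //.
rewrite -ler_pdivrMr //; lra.
Qed.

(** Divide by (p n)^(2 E) and use 1 - 2 / p^2 <= exp (- 2 / p^2); what remains is 2 n (1 + ln p) < 2
    E / p^2. *)
Lemma edge_count_sufficient (R : realType) (p n E : nat) : (1 < p)%N -> (0 < n)%N ->
  p%:R ^+ 2 * n%:R * (1 + ln p%:R) < E%:R :> R ->
  ('C(p * n, n) ^ 2 * ((p * n) ^ 2 - 2 * n ^ 2) ^ E < ((p * n) ^ 2) ^ E)%N.
Proof.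
move=> p1 n0 hE.
have p0R : (0 : R) < p%:R by rewrite ltr0n (ltn_trans _ p1).
have n0R : (0 : R) < n%:R by rewrite ltr0n.
have le2 : (2 * n ^ 2 <= (p * n) ^ 2)%N.
  rewrite expnMn leq_mul2r; apply/orP; right; apply: leq_trans (_ : 2 ^ 2 <= _)%N => //.
  by rewrite leq_exp2r.
rewrite -(ltr_nat R) natrM !natrX natrB // [(2 * n ^ 2)%:R]natrM !natrX !natrM.
set c : R := 'C(_, _)%:R.
have cle : c <= expR (n%:R * (1 + ln p%:R)) by apply: binomial_le_expR; exact: ltnW.
have -> : (p%:R * n%:R) ^+ 2 - 2%:R * n%:R ^+ 2 = (p%:R * n%:R) ^+ 2 * (1 - 2 / p%:R ^+ 2) :> R.
  by field; rewrite gt_eqF.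
have pn0 : 0 < ((p%:R * n%:R) ^+ 2) ^+ E :> R by rewrite !exprn_gt0 ?mulr_gt0.
rewrite exprMn mulrCA gtr_pMr //.
set q : R := 1 - 2 / p%:R ^+ 2.
have q0 : 0 <= q.
  rewrite subr_ge0 ler_pdivrMr ?exprn_gt0 // mul1r -natrX ler_nat.
  by apply: leq_trans (_ : 2 ^ 2 <= _)%N => //; rewrite leq_exp2r.
have qle : q <= expR (- (2 / p%:R ^+ 2)) by apply: expR_ge1Dx.
apply: (@le_lt_trans _ _ (expR (n%:R * (1 + ln p%:R)) ^+ 2 * expR (- (2 / p%:R ^+ 2)) ^+ E)).
  apply: ler_pM; rewrite ?exprn_ge0 ?ler0n //.
    by rewrite lerXn2r // nnegrE ?ler0n ?expR_ge0.
  by rewrite lerXn2r // nnegrE ?expR_ge0.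
rewrite -!expRM_natl -expRD -[X in _ < X]expR0 ltr_expR.
rewrite -(ltr_pM2l (exprn_gt0 2 p0R)) mulr0.
have -> : p%:R ^+ 2 * (2%:R * (n%:R * (1 + ln p%:R)) + E%:R * - (2 / p%:R ^+ 2)) =
   2 * (p%:R ^+ 2 * n%:R * (1 + ln p%:R)) - 2 * E%:R :> R.
  by field; rewrite gt_eqF.
lra.
Qed.

(** * The degree condition at a = 1 *)

Lemma gE (R : realType) (x : R) : Defs.g x = x * ln x.
Proof. by rewrite /Defs.g; case: eqP => // ->; rewrite mul0r. Qed.

(** At a = 1 all terms in ln d cancel and the condition becomes linear in d. Tangent bounds for ln
    show that the coefficient of d is at most 3 / (c - 2). *)
Lemma degree_lower_bound (R : realType) (c : R) (d : nat) : 82 <= c ->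
  phi 1 c d%:R <= 0 -> (c - 2) * (2 * ln c + 2 * (c - 2) / c) <= 3 * d%:R.
Proof.
move=> c82; rewrite /phi !gE subrr !mul0r !mulr0 subr0 !mul1r.
have L1 := @ln_sub_le R (c - 3) (c - 2).
have L2 := @ln_sub_le R c (c - 2).
have L3 := @ln_sub_le R (c - 2) c.
have c0 : 0 < c by lra.
have c2 : 0 < c - 2 by lra.
have c3 : 0 < c - 3 by lra.
have {}L1 := L1 c3 c2; have {}L2 := L2 c0 c2; have {}L3 := L3 c2 c0.
have {L3} L3' : 2 * ln c + 2 * (c - 2) / c <= c * ln c - (c - 2) * ln (c - 2).
  have := ler_wpM2l (ltW c2) L3.
  have -> : (c - 2) * ((c - 2 - c) / c) = - (2 * (c - 2) / c) by field; rewrite gt_eqF.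
  lra.
have lc : 0 <= ln c by apply: ln_ge0; lra.
have pos : 0 < 2 * ln c + 2 * (c - 2) / c.
  by apply: ltr_wpDl; rewrite ?mulr_ge0 // divr_gt0 // mulr_gt0.
(* For d = 0 the logarithms of products cannot be expanded; there the condition reads g(c) <= g(c -
   2), contradicting [L3'] and [pos]. *)
case: d => [|d].
  rewrite !mulr0 !mul0r !mulr0; lra.
have d0 : (0 : R) < d.+1%:R by rewrite ltr0n.
move: (d.+1%:R : R) d0 => {d} d d0.
have -> : c - 1 - 1 = c - 2 by ring.
have -> : c - 2 - 1 = c - 3 by ring.
rewrite !lnM ?posrE // => H.
have M1 := ler_wpM2l (ltW c3) L1.
have M2 := ler_wpM2l (ltW c0) L2.
set x := ln c in H L3' M1 M2 *; set y := ln (c - 2) in H L3' M1 M2; set z := ln (c - 3) in H M1.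
set w := ln d in H.
have K : d * ((c - 3) * (z - y) + 2^-1 * c * (x - y)) >= c * x - (c - 2) * y.
  suff -> : d * ((c - 3) * (z - y) + 2^-1 * c * (x - y)) =
    c * x - (c - 2) * y - (c * x + d * w + (c - 2) * d * (y + w) + 2^-1 * ((c - 2) * d * (y + w)) -
    (c - 2) * y - d * w - (c - 3) * d * (z + w) - 2^-1 * (c * d * (x + w))) by lra.
  by field.
have S : (c - 3) * (z - y) + 2^-1 * c * (x - y) <= 3 / (c - 2).
  have -> : 3 / (c - 2) = (c - 3) * ((c - 3 - (c - 2)) / (c - 2)) + 2^-1 * (c * ((c - (c - 2)) / (c - 2))).
    by field; rewrite gt_eqF.
  lra.
have := ler_wpM2l (ltW d0) S => S'.
rewrite mulrC -ler_pdivlMr //.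
have -> : 3 * d / (c - 2) = d * (3 / (c - 2)) by ring.
lra.
Qed.

(** With E = c n d / 2 and the lower bound on d, the leading terms in c^2 ln c compare as (27/50)^2
    = 729/2500 < 1/3. *)
Lemma enough_edges (R : realType) (c : R) (d p n E : nat) :
  82 <= c -> phi 1 c d%:R <= 0 -> (1 < p)%N -> p%:R <= 27 / 50 * c -> (0 < n)%N ->
  c * n%:R * d%:R = (2 * E)%:R ->
  p%:R ^+ 2 * n%:R * (1 + ln p%:R) < E%:R :> R.
Proof.
move=> c82 /(degree_lower_bound c82) hd p1 pc n0; rewrite natrM => hE.
have n0R : (0 : R) < n%:R by rewrite ltr0n.
have p1R : (1 : R) < p%:R by rewrite ltr1n.
have c0 : 0 < c by lra.
have p0 : 0 < p%:R :> R by lra.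
have lnp : ln p%:R <= ln c by rewrite ler_ln ?posrE //; lra.
have lnp0 : 0 < ln p%:R :> R by apply: ln_gt0.
set L := ln c in lnp hd *.
have step : p%:R ^+ 2 * n%:R * (1 + ln p%:R) <= (27 / 50 * c) ^+ 2 * n%:R * (1 + L).
  apply: ler_pM; [by rewrite mulr_ge0 ?exprn_ge0 ?ltW|lra| |lra].
  apply: ler_wpM2r; first exact: ltW.
  by rewrite lerXn2r ?nnegrE //; lra.
apply: le_lt_trans step _.
have -> : E%:R = c * n%:R * (3 * d%:R) / 6 :> R by lra.
apply: lt_le_trans (_ : c * n%:R * ((c - 2) * (2 * L + 2 * (c - 2) / c)) / 6 <= _); last first.
  by rewrite ler_pM2r ?invr_gt0 // ler_pM2l ?mulr_gt0.
have -> : c * n%:R * ((c - 2) * (2 * L + 2 * (c - 2) / c)) / 6 =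
  n%:R * ((c - 2) * (c * L + c - 2) / 3) by field; rewrite gt_eqF.
have -> : (27 / 50 * c) ^+ 2 * n%:R * (1 + L) = n%:R * ((27 / 50 * c) ^+ 2 * (1 + L)) by ring.
rewrite ltr_pM2l //.
have L0 : 0 < L by lra.
have cL : 0 < c * L by rewrite mulr_gt0.
(* As c >= 82, the gap between 729/2500 and 1/3 absorbs the lower order terms; these products are
   the hints for [nra]. *)
have ccL : 0 <= (c - 82) * (c * L) by apply: mulr_ge0; [lra|exact: ltW].
have cc : 0 <= (c - 82) * c by apply: mulr_ge0; lra.
rewrite (_ : (27 / 50 * c) ^+ 2 * (1 + L) = 729 / 2500 * (c * c) + 729 / 2500 * (c * (c * L))); last by field.
rewrite (_ : (c - 2) * (c * L + c - 2) / 3 = (c * (c * L) - 2 * (c * L) + c * c - 4 * c + 4) / 3); last by field.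
nra.
Qed.

(** * Comparison of the constants *)

Lemma fconstE (R : realType) te k :
  fconst R te k = 82 / 1225 * 35 ^+ (2 ^ k) * 81 ^+ te.
Proof.
rewrite /fconst expfzDr ?pnatr_eq0 //.
have -> : (35 : R) ^ (- 2%:Z) = 1225^-1 by rewrite -exprnN -natrX.
by rewrite -exprnP; field.
Qed.

(** The base case is 44 <= 27/50 * 82 = 44.28. Passing from x to 21 x^2 while 35^(2^k) is squared
    preserves the bound because 21 * 27/50 * 82/1225 < 1. *)
Lemma odd_bound_le (R : realType) k :
  (odd_bound k.+1)%:R <= 27 / 50 * (82 / 1225 * 35 ^+ (2 ^ k.+1)) :> R.
Proof.
elim: k => [|k IH]; first by rewrite /= (_ : (2 ^ 1 = 2)%N) //; lra.
have -> : odd_bound k.+2 = (21 * odd_bound k.+1 ^ 2)%N by [].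
rewrite natrM natrX.
rewrite [X in 35 ^+ X]expnSr exprM.
set y := 35 ^+ _ in IH *; set x := _%:R in IH *.
have x0 : 0 <= x by apply: ler0n.
have y0 : 0 <= y by apply: exprn_ge0.
have : x ^+ 2 <= (27 / 50 * (82 / 1225 * y)) ^+ 2 by rewrite lerXn2r // nnegrE; lra.
have := sqr_ge0 y; lra.
Qed.

Lemma pow35_ge (R : realType) k : 35 ^+ (2 ^ k.+1) >= 1225 :> R.
Proof.
have -> : 1225 = 35 ^+ 2 :> R by rewrite -natrX.
by apply: ler_weXn2l; rewrite ?ler1n // -{1}(expn1 2) leq_exp2l.
Qed.

(* The factor 27/50 < 1/sqrt 3 is what makes a host on (27/50) N vertices
   affordable with N d / 2 edges, see enough_edges. *)
Lemma cconst_bounds (R : realType) te k : (0 < te + k)%N ->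
  82 <= cconst R (te + k) te k /\
  (odd_bound k * 21 ^ te)%:R <= 27 / 50 * cconst R (te + k) te k.
Proof.
move=> tk; rewrite natrM natrX.
have w1 n : 1 <= 81 ^+ n :> R by rewrite exprn_ege1 // ler1n.
have w2 n : 0 <= 21 ^+ n :> R by rewrite exprn_ge0.
have w3 n : 21 ^+ n <= 81 ^+ n :> R by rewrite lerXn2r ?nnegrE // ler_nat.
have [f82 fb] : 82 <= fconst R te k /\ (odd_bound k)%:R * 21 ^+ te <= 27 / 50 * fconst R te k.
  rewrite fconstE; case: k tk => [|k] tk.
    rewrite expn0 expr1; case: te tk => [//|te] _; rewrite !exprS /=.
    by have := w1 te; have := w3 te; have := w2 te; lra.
  have h := pow35_ge R k; have o := odd_bound_le R k.
  set y := 35 ^+ _ in h o *.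
  split.
    have : 82 <= 82 / 1225 * y by lra.
    by move=> h'; rewrite -[82]mulr1; apply: ler_pM => //; lra.
  by rewrite (mulrA (27 / 50)); apply: ler_pM.
rewrite /cconst; case: eqP => // tk2.
split; first by rewrite le_min f82 andbT; lra.
rewrite minr_pMr; last by lra.
rewrite le_min fb andbT.
(* For two colours only three parity patterns remain; the largest bound is 21 * 44^2 = 40656, below
   27/50 * 95412. *)
case: te k tk2 {tk f82 fb} => [|[|[|te]]] [|[|[|k]]] //; rewrite ?addnS // => _.
- have -> : odd_bound 2 = (21 * 44 ^ 2)%N by [].
  by rewrite natrM natrX expr0; lra.
- by rewrite expr1 /=; lra.
- by rewrite /=; lra.
Qed.

Lemma exp2_ceil_log2 (R : realType) (x : R) : 1 <= x ->
  exists T : nat, Num.ceil (log2 x) = T%:Z /\ x <= 2 ^+ T.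
Proof.
move=> x1; have l2 : 0 < ln 2 :> R by apply: ln_gt0; rewrite ltr1n.
have l0 : 0 <= log2 x by apply: divr_ge0; [exact: ln_ge0|exact: ltW].
have c0 : 0 <= Num.ceil (log2 x) by rewrite ceil_ge0; apply: lt_le_trans l0; rewrite ltrN10.
have [T TE] : exists T : nat, Num.ceil (log2 x) = T%:Z.
  by exists `|Num.ceil (log2 x)|%N; rewrite gez0_abs.
exists T; split=> //; have := ceil_ge (log2 x); rewrite TE ler_pdivrMr // => h.
have x0 : 0 < x by apply: lt_le_trans x1.
rewrite -ler_ln ?posrE ?exprn_gt0 // lnXn // -[leRHS]mulr_natl; exact: h.
Qed.

Lemma card_set_filter (I : finType) (P : pred I) :
  #|[set i | P i]| = size [seq i <- enum I | P i].
Proof.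
rewrite -(card_uniqP (filter_uniq P (enum_uniq I))).
by apply: eq_card => i; rewrite inE mem_filter mem_enum andbT.
Qed.

(** * Assembling the upper bound *)

Theorem theorem3p4 (R : realType) (t te : nat) (d : nat) :
  (1 <= t)%N -> (te <= t)%N ->
  (forall a : R, 0 <= a <= 1 -> phi a (cconst R t te (t - te)) d%:R <= 0) ->
  exists N0 : R, forall ks : 'I_t -> nat,
    (forall i, 0 < ks i)%N ->
    #|[set i | ~~ odd (ks i)]| = te ->
    let N : R := cconst R t te (t - te) * (\max_(i < t) ks i)%:R in
    N0 <= N ->
    (exists k : nat, N * d%:R = (2 * k)%:R) ->
    (forall i, 2 * (Num.ceil (log2 N))%:~R + 2 <= (ks i)%:R :> R) ->
    size_ramsey_le ks (N * d%:R / 2).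
Proof.
(* The estimates are explicit rather than asymptotic, which gives the threshold 0. *)
move=> t1 tet hphi; exists 0 => ks ks0 cte N _ [E hE] hks.
set to := (t - te)%N in N hphi hE hks *.
have tE : t = (te + to)%N by rewrite subnKC.
have [c82 pc] : 82 <= cconst R t te to /\
    (odd_bound to * 21 ^ te)%:R <= 27 / 50 * cconst R t te to.
  by have := @cconst_bounds R te to; rewrite -tE; apply.
set c := cconst R t te to in N hphi hE hks c82 pc *.
set n := (\max_(i < t) ks i)%N in N hE hks *.
set p := (odd_bound to * 21 ^ te)%N in pc *.
have ksn i : (ks i <= n)%N by rewrite /n (leq_bigmax i).
have n0 : (0 < n)%N by have := ksn (Ordinal t1); apply: leq_trans; exact: ks0.
have n0R : 1 <= n%:R :> R by rewrite ler1n.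
have p1 : (1 < p)%N.
  by rewrite /p; apply: leq_trans (odd_bound_gt1 to) (leq_pmulr _ _); rewrite expn_gt0.
have N1 : 1 <= N by rewrite /N; nra.
have [T [TE NT]] := exp2_ceil_log2 N1.
(* The host has p n <= 27/50 N vertices, so T, the ceiling of log N, bounds the branching depth at
   every scale. *)
have MT : (#|'I_(p * n)| <= 2 ^ T)%N.
  rewrite card_ord -(ler_nat R) natrX natrM; apply: le_trans NT; rewrite /N.
  by rewrite ler_pM2r; [lra|lra].
have lT i : (T.*2 + 2 <= ks i <= n)%N.
  rewrite ksn andbT -(ler_nat R) natrD -mul2n natrM.
  by have := hks i; rewrite TE.
have [e [sg ce he]] : exists e : rel 'I_(p * n),
    [/\ simple_graph e, (#|edge_set e| <= E)%N &
    forall A B : {set 'I_(p * n)}, [disjoint A & B] -> (n <= #|A|)%N ->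
      (n <= #|B|)%N -> ~ edge_free e A B].
  apply/host_graph/(@edge_count_sufficient R) => //.
  by apply: (@enough_edges R c d) => //; apply: hphi; rewrite ler01 lexx.
exists #|edge_set e|; split; last first.
  by rewrite hE natrM mulrC mulrA mulVf ?mul1r ?ler_nat // pnatr_eq0.
exists (p * n)%N, e; split=> //; split=> // col.
apply: contrapT => nomono.
pose H i := [rel x y : 'I_(p * n) | e x y && (col [set x; y] == i)].
have noC i : ~ has_cycle (H i) (ks i).
  by move=> hc; apply: nomono; exists i; apply: mono_cycle_of_has_cycle (ks0 i).
have sH i : symmetric (H i) by move=> x y; rewrite /H /= sg.1 finset.setUC.
pose so := [seq i <- enum 'I_t | odd (ks i)].
pose se := [seq i <- enum 'I_t | ~~ odd (ks i)].
have szse : size se = te by rewrite -cte card_set_filter.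
have szso : size so = to.
  have : (size so + size se)%N = t by rewrite !size_filter count_predC size_enum_ord.
  by rewrite szse => h; apply: (@addIn te); rewrite h addnC -tE.
have spl := @splits_colours _ _ n T H ks so se n0 MT sH lT noC (filter_all _ _) (filter_all _ _).
rewrite szse szso in spl.
(* At scale n the whole vertex set, of size p n, is just large enough to split; the result is two
   n-sets with no edge in any colour, which the host excludes. *)
have [||X [Y [_ dXY nX nY fXY]]] := spl n [set: 'I_(p * n)]; rewrite ?cardsT ?card_ord //.
apply: (he X Y dXY nX nY) => x y xX yY; apply: contra (fXY x y xX yY) => exy /=.
apply/hasP; exists (col [set x; y]); last by rewrite exy eqxx.
rewrite mem_cat; apply/orP; have [ok|ok] := boolP (odd (ks (col [set x; y]))).
  by right; rewrite mem_filter ok mem_enum.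
by left; rewrite mem_filter ok mem_enum.
Qed.
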